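(* For any $h,v$ with $hv\ge n^2$, there is an $[m+h,v]$-scheme for \textsc{TriangleCount}, where $m$ is the number of edges of the input graph. In particular, there is an $[m,n^2/m]$-scheme.
   Context: Annotated streaming model (schemes): a space-bounded Verifier reads an input stream $\sigma$; after the stream ends, an all-powerful Prover sends a help message to the Verifier as a stream. A scheme for a function $f$ consists of the Verifier's randomized streaming algorithm, the honest Prover's help function, and the Verifier's output procedure, outputting a value in $\mathrm{range}(f)\cup\{\bot\}$ ($\bot$ = reject), with perfect completeness (honest help makes the Verifier output $f(\sigma)$ with probability 1) and soundness error at most $1/3$ (for every $\sigma$ and every help message, the probability of outputting a value outside $\{f(\sigma),\bot\}$ is at most $1/3$). An $[h,v]$-scheme uses $\tilde{O}(h)$ bits of help and $\tilde{O}(v)$ bits of Verifier space, where $\tilde{O}$ hides factors polynomial in $\log n$. \textsc{TriangleCount}: the input is a graph on vertex set $[n]$ with $m$ edges, given as a stream of edges; the desired output is the number of triangles (sets of three edges of the form $\{\{u,v\},\{v,w\},\{u,w\}\}$) in the graph. *)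

(* Defs.v *)
From mathcomp Require Import all_boot.
Set Implicit Arguments. Unset Strict Implicit. Unset Printing Implicit Defensive.

(* An input stream: a sequence of edges {u,v} of a graph on [n] = 'I_n,
   each edge given as a pair (u,v) (read as the unordered pair). *)
Definition stream (n : nat) := seq ('I_n * 'I_n).

Definition valid_stream n (s : stream n) : bool :=
  all (fun e => e.1 != e.2) s && uniq (map (fun e => [set e.1; e.2]) s).

Definition num_edges n (s : stream n) : nat := size s.

Definition adj n (s : stream n) (x y : 'I_n) : bool :=
  has (fun e => ((e.1 == x) && (e.2 == y)) || ((e.1 == y) && (e.2 == x))) s.

Definition triangle_count n (s : stream n) : nat :=
  #|[set T : {set 'I_n} | (#|T| == 3) &&
       [forall x in T, forall y in T, (x != y) ==> adj s x y]]|.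

Definition mem (sp : nat) := {ffun 'I_sp -> bool}.

(* A randomized streaming verifier with sp bits of working memory.
   It draws rb uniformly random bits, which are used to set its initial
   memory; then it processes the input stream edge by edge, then the help
   stream bit by bit, and finally outputs Some value or None (= reject, ⊥).
   All information it keeps (including its randomness) must fit into the
   sp bits of memory. *)
Unset Implicit Arguments.
Record verifier (n : nat) := Verifier {
  v_space : nat;
  v_rbits : nat;
  v_init  : {ffun 'I_v_rbits -> bool} -> mem v_space;
  v_edge  : mem v_space -> 'I_n * 'I_n -> mem v_space;
  v_hbit  : mem v_space -> bool -> mem v_space;
  v_out   : mem v_space -> option nat }.

Set Implicit Arguments.
Arguments v_space {n}. Arguments v_rbits {n}. Arguments v_init {n}.
Arguments v_edge {n}. Arguments v_hbit {n}. Arguments v_out {n}.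
Definition run n (V : verifier n) (rho : {ffun 'I_(v_rbits V) -> bool})
    (s : stream n) (help : seq bool) : option nat :=
  v_out V (foldl (v_hbit V) (foldl (v_edge V) (v_init V rho) s) help).

Arguments run {n} V rho s help.

Record scheme (n : nat) := Scheme {
  s_ver  : verifier n;
  s_help : stream n -> seq bool }.

Definition complete n (S : scheme n) (f : stream n -> nat) : Prop :=
  forall s : stream n, valid_stream s ->
  forall rho, run (s_ver S) rho s (s_help S s) = Some (f s).

(* Soundness error at most 1/3: for every valid input and every help
   message, Pr_rho[output ∉ {f σ, ⊥}] <= 1/3 (probability over uniform rho). *)
Definition sound n (S : scheme n) (f : stream n -> nat) : Prop :=
  forall s : stream n, valid_stream s -> forall help : seq bool,
  3 * #|[set rho | (run (s_ver S) rho s help != Some (f s)) &&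
                   (run (s_ver S) rho s help != None)]|
    <= 2 ^ v_rbits (s_ver S).

Definition polylog (n c : nat) : nat := (trunc_log 2 n).+1 ^ c.

(* Main.v *)
Require Import Defs.
From mathcomp Require Import all_boot all_algebra zify.
Set Implicit Arguments. Unset Strict Implicit. Unset Printing Implicit Defensive.
Import GRing.Theory.

(* Orient every edge upwards, write D for the resulting 0/1 matrix and B = D^2;
   the number of triangles is the sum of D(u, v) B(u, v).  A vertex u is split as
   (u %/ b, u %% b) with b about sqrt v.  For residues (i, j), let F_ij(X) be the
   sum of X^e(u, v) over the arcs with these residues, and let G_ij(X) be the sum
   of B(u, v) X^(W - e(u, v)) over the pairs with these residues, where e is
   injective on pairs of quotients: the coefficient of X^W in sum_ij F_ij G_ij is
   the number of triangles.  The verifier keeps F_ij(x) at one random point x of a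
   prime field.  G_ij = sum_z alpha_i(z) beta_j(z) with alpha (beta) coming from the
   arcs into (out of) z, so G_ij(x) can be accumulated in b^2 cells if the prover
   replays the arcs grouped by z; replaying them in increasing order of their codes
   makes them distinct, and the fingerprint sum x^code compares them with the
   input.  Finally the prover sends the coefficients of sum_ij F_ij G_ij. *)

(** * Primes in [2^k, 2^(2k+3)] *)

Lemma expn2_le_bin_mid m : 2 ^ m <= 'C(m.*2, m).
Proof.
elim: m => [|m IHm] //; rewrite doubleS expnS mul2n -addnn binS.
apply: leq_add; first by apply: leq_trans IHm _; rewrite binS leq_addl.
exact/(leq_trans IHm)/leq_bin2l.
Qed.

Lemma sum_nat_leq t N : \sum_(1 <= k < N.+1) (k <= t) = minn t N.
Proof.
elim: N => [|N IHN]; first by rewrite big_geq // minn0.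
rewrite big_nat_recr //= IHN; lia.
Qed.

(** By Legendre's formula the exponent of [p] is the sum over [k] of [(2m) %/ p^k - 2 (m %/ p^k)];
    each term is at most 1 and vanishes once [p^k > 2m]. *)
Lemma pfactor_bin_mid_leq p m :
  prime p -> 0 < m -> p ^ logn p 'C(m.*2, m) <= m.*2.
Proof.
move=> p_pr m_gt0; set M := m.*2.
have p_gt1 := prime_gt1 p_pr.
have M_gt0 : 0 < M by rewrite double_gt0.
suff: logn p 'C(M, m) <= trunc_log p M.
  move=> le; apply: leq_trans (trunc_logP p_gt1 M_gt0).
  by rewrite leq_exp2l.
have mM : m <= M by rewrite /M; lia.
have /(congr1 (logn p)) := bin_fact mM.
rewrite !lognM ?muln_gt0 ?fact_gt0 ?bin_gt0 //.
rewrite (_ : M - m = m); last by rewrite /M; lia.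
rewrite !logn_fact //.
(* The added terms vanish because [m < k] there and [k < p ^ k]. *)
have -> : \sum_(1 <= k < m.+1) m %/ p ^ k = \sum_(1 <= k < M.+1) m %/ p ^ k.
  rewrite [RHS](@big_cat_nat _ _ _ m.+1) //=.
  rewrite [X in _ = _ + X]big_nat_cond [X in _ = _ + X]big1 ?addn0 // => i.
  case/andP=> /andP[mi _] _; apply: divn_small.
  exact: leq_trans mi (ltnW (ltn_expl _ p_gt1)).
rewrite addnn -muln2 big_distrl /= => eqL.
suff: \sum_(1 <= k < M.+1) M %/ p ^ k <=
      \sum_(1 <= k < M.+1) m %/ p ^ k * 2 + trunc_log p M by lia.
apply: (@leq_trans (\sum_(1 <= k < M.+1) (m %/ p ^ k * 2 + (k <= trunc_log p M)))).
  rewrite !big_nat; apply: leq_sum => k /andP[k1 kM].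
  case: (leqP k (trunc_log p M)) => [le_k|lt_k]; last first.
    rewrite divn_small // (leq_trans (trunc_log_ltn _ p_gt1)) //.
    by rewrite leq_exp2l.
  have p0 : 0 < p ^ k by rewrite expn_gt0 prime_gt0.
  rewrite -ltnS ltn_divLR //.
  have := ltn_ceil m p0; rewrite /M; nia.
by rewrite big_split /= sum_nat_leq leq_add2l geq_minl.
Qed.

(** A Chebyshev argument: if all primes dividing the binomial were at most [N], it would be a
    product of at most [N] prime powers, each at most [2m], hence at most [2^((2k+3)N)]. As
    [m = 4 N^2] and [k < N], this is below [2^m], a lower bound for the binomial. *)
Lemma exists_prime_between k : exists2 p, prime p & 2 ^ k < p <= 2 ^ (2 * k + 3).
Proof.
set N := 2 ^ k; set m := 2 ^ (2 * k + 2).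
have m2 : m.*2 = 2 ^ (2 * k + 3) by rewrite -mul2n -expnS -addnS.
have m_gt0 : 0 < m by rewrite expn_gt0.
pose C := 'C(m.*2, m).
have C_gt0 : 0 < C by rewrite bin_gt0 -addnn leq_addl.
have primeC p : p \in primes C -> p <= m.*2.
  rewrite mem_primes => /and3P[p_pr _ pC].
  apply: leq_trans (pfactor_bin_mid_leq p_pr m_gt0).
  by rewrite -{1}[p]expn1 leq_pexp2l ?(prime_gt0 p_pr) // logn_gt0 mem_primes p_pr C_gt0.
case: (boolP (has (fun p => N < p) (primes C))) => [/hasP[p pC Np]|/hasPn primesN].
  exists p; first by move: pC; rewrite mem_primes => /andP[].
  by rewrite Np -m2 primeC.
suff: C < 2 ^ m by rewrite ltnNge expn2_le_bin_mid.
have szN : size (primes C) <= N.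
  rewrite -[N](size_iota 1); apply: uniq_leq_size; first exact: primes_uniq.
  move=> p pC; rewrite mem_iota add1n ltnS (leqNgt p) primesN // andbT.
  by move: pC; rewrite mem_primes => /andP[/prime_gt0].
apply: (@leq_ltn_trans (m.*2 ^ N)).
  rewrite (prod_prime_decomp C_gt0) prime_decompE big_map /=.
  apply: (@leq_trans (\prod_(p <- primes C) m.*2)).
    rewrite big_seq [leqRHS]big_seq; apply: leq_prod => p.
    by rewrite mem_primes => /andP[p_pr _]; exact: pfactor_bin_mid_leq.
  by rewrite big_const_seq count_predT iter_muln_1 leq_pexp2l ?double_gt0.
rewrite m2 -expnM ltn_exp2l // /m addn2 expnS [2 ^ _.+1]expnS mul2n -addnn expnD.
have : k < 2 ^ k by rewrite ltn_expl.
rewrite -/N; nia.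
Qed.

(** * From symbol machines to bit-level schemes *)

Lemma leq_card_cancel (A B : finType) (a0 : A) :
  #|A| <= #|B| -> exists f : A -> B, exists g : B -> A, cancel f g.
Proof.
move=> leAB; pose f x : B := enum_val (widen_ord leAB (enum_rank x)).
exists f, (fun y => odflt a0 [pick x | f x == y]) => x.
have f_inj : injective f.
  by move=> y z /enum_val_inj/(congr1 val)/= /ord_inj/enum_rank_inj.
by case: pickP => [y /eqP/f_inj //|/(_ x)]; rewrite eqxx.
Qed.

Section Machine.
Variables (n rb kb sp : nat) (Q A : finType).
Variables (q0 : Q) (a0 : A).
Variables (init : {ffun 'I_rb -> bool} -> Q) (edge : Q -> 'I_n * 'I_n -> Q)
  (sym : Q -> A -> Q) (out : Q -> option nat).

Definition sym_run rho s t := out (foldl sym (foldl edge (init rho) s) t).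

Section Codec.
Variables (enc : A -> {ffun 'I_kb -> bool}) (dec : {ffun 'I_kb -> bool} -> A).

Definition block (w : seq bool) : A := dec [ffun i : 'I_kb => nth false w i].
Definition unblock (a : A) : seq bool := codom (enc a).

Definition bit_step (qw : Q * kb.-bseq bool) (b : bool) : Q * kb.-bseq bool :=
  let w := rcons qw.2 b in
  if size w < kb then (qw.1, insub_bseq kb w) else (sym qw.1 (block w), [bseq]).

Lemma size_unblock a : size (unblock a) = kb.
Proof. by rewrite size_codom card_ord. Qed.

Lemma unblockK : cancel enc dec -> cancel unblock block.
Proof.
move=> encK a; rewrite -[RHS]encK /block; congr dec; apply/ffunP => i.
rewrite ffunE /unblock /codom /image_mem (nth_map i) ?size_enum_ord //.
by rewrite nth_ord_enum.
Qed.

Lemma foldl_bit_step_short q (w : kb.-bseq bool) u : size w + size u < kb ->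
  foldl bit_step (q, w) u = (q, insub_bseq kb (w ++ u)).
Proof.
elim: u w => [|b u IHu] w /= lt_wu.
  by rewrite cats0 /insub_bseq valKd.
have szw : size (rcons w b) < kb by rewrite size_rcons; lia.
have valw : insub_bseq kb (rcons w b) = rcons w b :> seq bool.
  by rewrite /insub_bseq insubdK //; exact: ltnW.
rewrite [bit_step _ _]/bit_step /= szw IHu ?valw ?size_rcons ?cat_rcons //; lia.
Qed.

Lemma foldl_bit_step_block q w : 0 < kb -> size w = kb ->
  foldl bit_step (q, [bseq]) w = (sym q (block w), [bseq]).
Proof.
move=> kb_gt0; case/lastP: w => [/= szw|w b]; first by rewrite -szw in kb_gt0.
rewrite size_rcons => szw; rewrite foldl_rcons foldl_bit_step_short ?add0n; last by lia.
rewrite /bit_step /insub_bseq insubdK /=; last by rewrite unfold_in; lia.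
by rewrite size_rcons szw ltnn.
Qed.

Lemma foldl_bit_step_unblock q t : 0 < kb -> cancel enc dec ->
  foldl bit_step (q, [bseq]) (flatten (map unblock t)) = (foldl sym q t, [bseq]).
Proof.
move=> kb_gt0 encK; elim: t q => //= a t IHt q.
by rewrite foldl_cat foldl_bit_step_block ?size_unblock // unblockK.
Qed.

(* Incomplete trailing blocks are ignored, so a bit string always acts as some
   string of symbols, independently of the verifier's state. *)
Lemma foldl_bit_step_sym u : 0 < kb ->
  exists t, forall q, (foldl bit_step (q, [bseq]) u).1 = foldl sym q t.
Proof.
move=> kb_gt0; have [m] := ubnP (size u); elim: m u => // m IHm u.
rewrite ltnS => szu; case: (ltnP (size u) kb) => [lt_u|le_u].
  by exists [::] => q; rewrite foldl_bit_step_short.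
have [|t tP] := IHm (drop kb u); first by rewrite size_drop; lia.
exists (block (take kb u) :: t) => q.
by rewrite -{1}(cat_take_drop kb u) foldl_cat foldl_bit_step_block ?size_takel.
Qed.

End Codec.

(** This lets the protocol be designed with an abstract finite state and help alphabet; the help
    bits are buffered into blocks of [kb] bits, one per symbol. *)
Lemma machine_scheme (f : stream n -> nat) (help : stream n -> seq A) :
    0 < kb -> #|Q| <= 2 ^ sp -> #|A| <= 2 ^ kb ->
    (forall s, valid_stream s -> forall rho, sym_run rho s (help s) = Some (f s)) ->
    (forall s, valid_stream s -> forall t : seq A,
       3 * #|[set rho | (sym_run rho s t != Some (f s)) &&
                        (sym_run rho s t != None)]| <= 2 ^ rb) ->
  exists S : scheme n, [/\ complete S f, sound S f,
    v_space (s_ver S) = sp + kb.+1 &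
    forall s, size (s_help S s) = kb * size (help s)].
Proof.
move=> kb_gt0 leQ leA cmpl snd.
have [|enc [dec encK]] := @leq_card_cancel A {ffun 'I_kb -> bool} a0.
  by rewrite card_ffun card_bool card_ord.
have [|mem_of [of_mem memK]] :=
    @leq_card_cancel (Q * kb.-bseq bool)%type (Defs.mem (sp + kb.+1)) (q0, [bseq]).
  rewrite card_prod card_ffun card_bool card_ord expnD leq_mul // card_bseq card_bool.
  (* The buffer takes [2^(kb+1) - 1] values, which costs [kb.+1] bits of memory. *)
  by have := predn_exp 2 kb.+1; rewrite /= mul1n => <-; exact: leq_pred.
pose V := @Verifier n (sp + kb.+1) rb
  (fun rho => mem_of (init rho, [bseq]))
  (fun m e => mem_of (edge (of_mem m).1 e, (of_mem m).2))
  (fun m b => mem_of (bit_step dec (of_mem m) b))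
  (fun m => out (of_mem m).1).
pose S := Scheme V (fun s => flatten (map (unblock enc) (help s))).
have runE rho s u : run (s_ver S) rho s u =
    out (foldl (bit_step dec) (foldl edge (init rho) s, [bseq]) u).1.
  rewrite /run.
  have -> : forall q, foldl (v_edge (s_ver S)) (mem_of (q, [bseq])) s =
                      mem_of (foldl edge q s, [bseq]).
    by elim: s => //= e s IHs q; rewrite memK IHs.
  have <- // : forall q, of_mem (foldl (v_hbit (s_ver S)) (mem_of q) u) =
                         foldl (bit_step dec) q u.
  by elim: u => [|b u IHu] q /=; rewrite memK ?IHu.
exists S; split => //.
- move=> s vs rho; rewrite runE (foldl_bit_step_unblock _ _ kb_gt0 encK).
  exact: cmpl.
(* The symbol string [t] does not depend on [rho], so the bad set for the bits [u] lies in the bad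
   set for this single [t]. *)
- move=> s vs u; have [t tP] := foldl_bit_step_sym dec u kb_gt0.
  apply: leq_trans (snd s vs t); rewrite leq_mul2l /=; apply/subset_leq_card.
  by apply/subsetP => rho; rewrite !in_set /sym_run -tP -(runE rho s u).
- move=> s /=; rewrite size_flatten /shape -map_comp.
  rewrite (eq_map (g := fun=> kb)); last by move=> a; exact: size_unblock.
  by elim: (help s) => [|a t /= ->]; rewrite ?muln0 // mulnS.
Qed.

End Machine.

(** * Triangles and oriented edges *)

Section Graph.
Variables (n : nat) (s : stream n).

Definition darc (x y : 'I_n) : bool := (x < y) && adj s x y.
Definition orient (e : 'I_n * 'I_n) := if e.1 < e.2 then e else (e.2, e.1).

Lemma adjC x y : adj s x y = adj s y x.
Proof. by apply: eq_has => e; rewrite orbC. Qed.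

Lemma orient_set e : [set (orient e).1; (orient e).2] = [set e.1; e.2].
Proof. by rewrite /orient; case: ifP => //= _; rewrite setUC. Qed.

Lemma mem_orient x y : all (fun e => e.1 != e.2) s ->
  ((x, y) \in map orient s) = darc x y.
Proof.
move=> /allP irr; apply/mapP/andP => [[e es]|[ltxy /hasP[e es]]].
  have := irr e es; case: e es => u v /= uv neq; rewrite /orient /=.
  case: (ltngtP u v) => [ltuv|ltvu|/val_inj eqv]; last by rewrite eqv eqxx in neq.
    by case=> -> ->; split=> //; apply/hasP; exists (u, v); rewrite //= !eqxx.
  by case=> -> ->; split=> //; apply/hasP; exists (u, v); rewrite //= !eqxx orbT.
case/orP=> /andP[/eqP e1 /eqP e2]; exists e => //; rewrite /orient e1 e2 ?ltxy //.
  by case: (e) e1 e2 => ? ? /= -> ->.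
by rewrite ltnNge (ltnW ltxy).
Qed.

(** In a valid stream [orient] is a bijection from the entries onto the arcs: equal oriented pairs
    would give equal edge sets. *)
Lemma sum_orient (V : nmodType) (phi : 'I_n * 'I_n -> V) : valid_stream s ->
  (\sum_(e <- s) phi (orient e) = \sum_(x | darc x.1 x.2) phi x)%R.
Proof.
case/andP=> irr us; rewrite -(big_map orient predT phi) big_uniq /=.
  by apply: eq_bigl => -[x y]; rewrite mem_orient.
apply: (@map_uniq _ _ (fun e => [set e.1; e.2])).
by rewrite -map_comp (eq_map (g := fun e => [set e.1; e.2])) // => e; exact: orient_set.
Qed.

(** The lemmas below take [x < z < y]: the long arc comes first and the middle vertex last. *)
Definition tri (x y z : 'I_n) := [set x; y; z].

Lemma card_tri (x y z : 'I_n) : (x < z) && (z < y) -> #|tri x y z| = 3.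
Proof.
case/andP=> xz zy; rewrite /tri -setUA cardsU1 cards2 !inE -!val_eqE /=; lia.
Qed.

Lemma tri_sorted (T : {set 'I_n}) : #|T| = 3 ->
  exists x y z : 'I_n, (x < z) && (z < y) /\ T = tri x y z.
Proof.
move=> T3; have /card_gt0P[x xT] : 0 < #|T| by rewrite T3.
case: (@arg_minnP _ x [in T] val xT) => {xT} {}x /= xT xmin.
have /card_gt0P[y yT] : 0 < #|T :\ x| by have := cardsD1 x T; rewrite xT; lia.
case: (@arg_maxnP _ y [in T :\ x] val yT) => {yT} {}y /= yT ymax.
have /eqP/cards1P[z Tz] : #|T :\ x :\ y| = 1.
  by have := cardsD1 x T; have := cardsD1 y (T :\ x); rewrite xT yT; lia.
have zT : z \in T :\ x :\ y by rewrite Tz inE.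
have ET : T = tri x y z.
  by rewrite /tri -setUA -Tz setD1K // setD1K.
exists x, y, z; split => //; move: zT; rewrite in_setD1 => /andP[zy zT].
have := ymax z zT; move: zT; rewrite in_setD1 => /andP[zx zT]; have := xmin z zT.
by move: zy zx; rewrite -!val_eqE /=; lia.
Qed.

Lemma tri_inj (x y z x' y' z' : 'I_n) : (x < z) && (z < y) -> (x' < z') && (z' < y') ->
  tri x y z = tri x' y' z' -> (x, y, z) = (x', y', z').
Proof.
move=> lt lt' E.
have Ei i : (i \in tri x y z) = (i \in tri x' y' z') by rewrite E.
have := (Ei x, Ei y, Ei z, Ei x', Ei y', Ei z').
rewrite !inE -!val_eqE /= !eqxx ?orbT => -[[[[[h1 h2] h3] h4] h5] h6].
by congr (_, _, _); apply/val_inj => /=; lia.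
Qed.

(** A triangle is determined by its long arc, from least to greatest vertex, and the middle of the
    two-arc path beside it. *)
Lemma triangle_countE :
  triangle_count s = \sum_(e | darc e.1 e.2) \sum_z (darc e.1 z && darc z e.2).
Proof.
pose P (t : 'I_n * 'I_n * 'I_n) :=
  [&& darc t.1.1 t.1.2, darc t.1.1 t.2 & darc t.2 t.1.2].
rewrite big_mkcond /=.
transitivity #|[set tri t.1.1 t.1.2 t.2 | t in [set t | P t]]|; last first.
  rewrite card_in_imset => [|[[x y] z] [[x' y'] z']]; last first.
    rewrite !inE /P /darc /= => /and3P[_ /andP[? _] /andP[? _]].
    by move=> /and3P[_ /andP[? _] /andP[? _]]; apply: tri_inj; apply/andP.
  rewrite cardsE -sum1_card big_mkcond /=.
  rewrite -(pair_bigA _ (fun e z => if P (e, z) then 1 else 0)) /=.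
  apply: eq_bigr => e _; rewrite /P /=; case: (darc e.1 e.2) => /=.
    by apply: eq_bigr => z _; case: ifP.
  by rewrite big1.
congr #|pred_of_set _|; apply/setP => T; rewrite inE; apply/andP/imsetP.
  case=> /eqP/tri_sorted[x [y [z [lt ->]]]] /forall_inP adjT.
  exists (x, y, z) => //; rewrite inE /P /darc /=.
  have A i j : i \in tri x y z -> j \in tri x y z -> i < j -> adj s i j.
    move=> iT jT ij; have /forall_inP/(_ j jT)/implyP := adjT i iT.
    by apply; rewrite -val_eqE /= neq_ltn ij.
  case/andP: lt => xz zy; have xy := ltn_trans xz zy.
  by rewrite xy xz zy !A // !inE eqxx ?orbT.
case=> -[[x y] z]; rewrite inE /P /darc /=.
move=> /and3P[/andP[xy axy] /andP[xz axz] /andP[zy azy]] ->; split.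
  by rewrite card_tri ?xz.
apply/forall_inP => i iT; apply/forall_inP => j jT; apply/implyP => neq.
move: iT jT neq; rewrite !inE => /orP[/orP[]|] /eqP-> /orP[/orP[]|] /eqP->;
  by rewrite ?eqxx // => _; rewrite // adjC.
Qed.

Lemma triangle_count_leq : triangle_count s <= n ^ 3.
Proof.
rewrite triangle_countE big_mkcond /=.
apply: (@leq_trans (\sum_(e : 'I_n * 'I_n) \sum_(z : 'I_n) 1)).
  apply: leq_sum => e _; case: ifP => // _; apply: leq_sum => z _; exact: leq_b1.
by rewrite !sum_nat_const card_prod !card_ord; lia.
Qed.

End Graph.

(** * Replayed arcs and the sketch polynomials *)

Section Items.
Variable n : nat.

(* [(z, false, u)] announces the arc u -> z and [(z, true, v)] the arc z -> v *)
Definition item := ('I_n * bool * 'I_n)%type.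
(** A mixed-radix encoding: increasing codes mean lexicographic order, so the items of a vertex [z]
    are contiguous, incoming arcs first. *)
Definition code (it : item) : nat := (it.1.1 * 2 + it.1.2) * n + it.2.
Definition code_lt (i j : item) := code i < code j.
Definition item_of (s : stream n) (it : item) : bool :=
  if it.1.2 then darc s it.1.1 it.2 else darc s it.2 it.1.1.
Definition replay (s : stream n) : seq item :=
  sort (relpre code leq) (enum (item_of s)).

Lemma ltn_code it : code it < 2 * n ^ 2.
Proof.
case: it => [[z d] u]; rewrite /code /=.
by have := ltn_ord z; have := ltn_ord u; case: d => /=; nia.
Qed.

Lemma code_inj : injective code.
Proof.
move=> [[z d] u] [[z' d'] u']; rewrite /code /= => E.
have n_gt0 : 0 < n by apply: leq_ltn_trans (ltn_ord u).
have := congr1 (modn^~ n) E; rewrite /= !modnMDl !modn_small // => /ord_inj eu.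
have := congr1 (divn^~ n) E; rewrite /= !divnMDl // !divn_small // !addn0.
case: d d' {E} => -[] /= E; try lia; rewrite eu; congr (_, _, _); apply: ord_inj; lia.
Qed.

Lemma code_vertex_mono i j : code i < code j -> i.1.1 <= j.1.1.
Proof.
case: i j => [[z d] u] [[z' d'] u']; rewrite /code /=.
by have := ltn_ord u; have := ltn_ord u'; case: d d' => -[] /=; nia.
Qed.

Lemma code_lt_trans : transitive code_lt.
Proof. by move=> j i k; exact: ltn_trans. Qed.

Lemma code_lt_uniq L : pairwise code_lt L -> uniq L.
Proof.
by rewrite -(sorted_pairwise code_lt_trans); apply: sorted_uniq => [|i];
  [exact: code_lt_trans | rewrite /code_lt ltnn].
Qed.

Variable s : stream n.

Lemma mem_replay it : (it \in replay s) = item_of s it.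
Proof. by rewrite mem_sort mem_enum. Qed.

Lemma replay_uniq : uniq (replay s).
Proof. by rewrite sort_uniq enum_uniq. Qed.

Lemma replay_pairwise : pairwise code_lt (replay s).
Proof.
have lt_tr : transitive ltn by move=> ? ? ?; exact: ltn_trans.
rewrite -(pairwise_map code ltn) -(sorted_pairwise lt_tr) ltn_sorted_uniq_leq.
rewrite (map_inj_uniq code_inj) replay_uniq sorted_map.
by apply: sort_sorted => i j; exact: leq_total.
Qed.

Lemma sum_replay (V : nmodType) (phi : item -> V) (P : pred item) :
  (\sum_(it <- replay s | P it) phi it = \sum_(it | item_of s it && P it) phi it)%R.
Proof.
rewrite big_mkcond big_uniq ?replay_uniq //= -big_mkcondr /=.
by apply: eq_bigl => it; rewrite mem_replay.
Qed.

(** Each arc is announced once at its head and once at its tail, so the fingerprint of the honest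
    replay can be computed from the input alone. *)
Lemma sum_replay_arcs (V : nmodType) (phi : item -> V) :
  (\sum_(it <- replay s) phi it = \sum_(e | darc s e.1 e.2)
      (phi (e.2, false, e.1) + phi (e.1, true, e.2)))%R.
Proof.
rewrite (sum_replay phi predT) (bigID (fun it : item => it.1.2)) /= addrC big_split /=.
congr (_ + _)%R.
  rewrite (reindex_onto (fun e : 'I_n * 'I_n => ((e.2, false, e.1) : item))
                        (fun it => (it.2, it.1.1))) /=.
    by apply: eq_bigl => -[x y]; rewrite /item_of /= eqxx !andbT.
  by move=> [[z d] u] /=; case: d; rewrite ?andbF.
rewrite (reindex_onto (fun e : 'I_n * 'I_n => ((e.1, true, e.2) : item))
                      (fun it => (it.1.1, it.2))) /=.
  by apply: eq_bigl => -[x y]; rewrite /item_of /= eqxx !andbT.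
by move=> [[z d] u] /=; case: d; rewrite ?andbF.
Qed.

Lemma size_replay : valid_stream s -> size (replay s) = 2 * size s.
Proof.
move=> vs; rewrite -!sum1_size.
have := @sum_orient n s nat (fun=> 2) vs; have := @sum_replay_arcs nat (fun=> 1).
rewrite /GRing.add /= => -> <-; rewrite big_distrr /=.
by apply: eq_bigr.
Qed.

End Items.

(** * Sketch polynomials, their degrees and coefficients *)

Section Sketch.
Local Open Scope ring_scope.
Variables (n a b : nat).
Hypotheses (b_gt0 : (0 < b)%N) (le_n_ab : (n <= a * b)%N).

Definition quo (u : 'I_n) : nat := u %/ b.
Definition res (u : 'I_n) : 'I_b := Ordinal (ltn_pmod u b_gt0).
Definition res2 (e : 'I_n * 'I_n) := (res e.1, res e.2).

Lemma ltn_quo u : (quo u < a)%N.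
Proof. by rewrite /quo ltn_divLR // (leq_trans (ltn_ord u)). Qed.

Lemma quo_res_inj u v : quo u = quo v -> res u = res v -> u = v.
Proof.
move=> eq /(congr1 val)/= er; apply: ord_inj.
by rewrite /= (divn_eq u b) (divn_eq v b) er -/(quo u) eq.
Qed.

(* Exponents are complementary: an arc (u, v) and a pair of items (z, false, u'),
   (z, true, v') with matching residues have exponents summing to a^2 - 1
   exactly when u = u' and v = v'. *)
Definition arc_exp (e : 'I_n * 'I_n) : nat := (quo e.1 + a * quo e.2)%N.
Definition item_exp (it : item n) : nat :=
  if it.1.2 then (a * (a.-1 - quo it.2))%N else (a.-1 - quo it.2)%N.

(** The exponent W of the target coefficient; in base [a] both its digits are [a - 1]. *)
Definition mid := (a * a).-1.

Lemma arc_exp_leq e : (arc_exp e <= mid)%N.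
Proof.
rewrite /arc_exp /mid; have := ltn_quo e.1; have := ltn_quo e.2; nia.
Qed.

Lemma arc_item_exp z (e : 'I_n * 'I_n) u v : res u = res e.1 -> res v = res e.2 ->
  (mid - arc_exp e == item_exp (z, false, u) + item_exp (z, true, v))%N =
  (u == e.1) && (v == e.2).
Proof.
case: e => x y /= ru rv; rewrite /item_exp /arc_exp /mid /=.
move: (ltn_quo u) (ltn_quo v) (ltn_quo x) (ltn_quo y) => qu qv qx qy.
have -> : (u == x) = (quo u == quo x).
  by apply/eqP/eqP => [->//|/quo_res_inj]; apply.
have -> : (v == y) = (quo v == quo y).
  by apply/eqP/eqP => [->//|/quo_res_inj]; apply.
apply/eqP/andP => [E|[/eqP-> /eqP->]]; last by nia.
have a_gt0 : (0 < a)%N by lia.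
(* Both sides are now two-digit numbers in base [a]; remainder and quotient by [a] compare the
   digits. *)
have {}E : ((a.-1 - quo y) * a + (a.-1 - quo x) =
            (a.-1 - quo v) * a + (a.-1 - quo u))%N by nia.
have := congr1 (modn^~ a) E; rewrite /= !modnMDl !modn_small; try lia.
have := congr1 (divn^~ a) E; rewrite /= !divnMDl // !divn_small; try lia.
Qed.

Section Values.
Variables (R : comNzRingType) (x : R).
Implicit Types (L : seq (item n)) (s : stream n).

(** These are [alpha_i(z)] for [d = false] and [beta_i(z)] for [d = true], taken over an arbitrary
    list since the prover may replay wrong items. The ring is left open: a field element [x] gives
    the verifier's values, ['X] the polynomials. *)
Definition colsum L z d i : R :=
  \sum_(it <- L | [&& it.1.1 == z, it.1.2 == d & res it.2 == i]) x ^+ item_exp it.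
Definition gmat L (y : 'I_b * 'I_b) : R :=
  \sum_z colsum L z false y.1 * colsum L z true y.2.
Definition fmat s (y : 'I_b * 'I_b) : R :=
  \sum_(e | darc s e.1 e.2 && (res2 e == y)) x ^+ arc_exp e.
Definition fprint L : R := \sum_(it <- L) x ^+ code it.
Definition inner s L : R := \sum_y fmat s y * gmat L y.

Lemma colsum_rcons L it z d i : colsum (rcons L it) z d i =
  colsum L z d i +
  (if [&& it.1.1 == z, it.1.2 == d & res it.2 == i] then x ^+ item_exp it else 0).
Proof.
rewrite /colsum -cats1 big_cat /= big_mkcond [X in _ + X]big_mkcond big_seq1.
by rewrite -big_mkcond.
Qed.

(** Only the summand of the item's own vertex changes, and only one of its two factors, so the
    increment is a monomial times the opposite column sum of the items already read. *)
Lemma gmat_rcons L it y : gmat (rcons L it) y = gmat L y +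
  (if it.1.2 then
     colsum L it.1.1 false y.1 * (if res it.2 == y.2 then x ^+ item_exp it else 0)
   else
     (if res it.2 == y.1 then x ^+ item_exp it else 0) * colsum L it.1.1 true y.2).
Proof.
rewrite /gmat (bigD1 it.1.1) //= [in RHS](bigD1 it.1.1) //=.
rewrite [X in _ = _ + X + _](_ : _ =
    \sum_(z | z != it.1.1) colsum (rcons L it) z false y.1 * colsum (rcons L it) z true y.2).
  rewrite -!addrA [_ + (if _ then _ else _)]addrC !addrA; congr (_ + _).
  rewrite !colsum_rcons !eqxx /=.
  by rewrite eqbF_neg eqb_id; case: it.1.2; rewrite /= addr0 ?mulrDl ?mulrDr.
apply: eq_bigr => z neq; rewrite !colsum_rcons.
by rewrite (eq_sym it.1.1 z) (negPf neq) /= !addr0.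
Qed.

Lemma perm_inner s L L' : perm_eq L L' -> inner s L = inner s L'.
Proof.
move=> pL; apply: eq_bigr => y _; congr (_ * _); apply: eq_bigr => z _.
by rewrite /colsum !(perm_big _ pL).
Qed.

Lemma colsum_replay s z d i :
  colsum (replay s) z d i =
  \sum_(u | item_of s (z, d, u) && (res u == i)) x ^+ item_exp (z, d, u).
Proof.
rewrite /colsum sum_replay (reindex_onto (fun u : 'I_n => ((z, d, u) : item n)) snd) /=.
  by apply: eq_bigl => u; rewrite !eqxx andbT.
by move=> [[z' d'] u] /and4P[_ /eqP/= -> /eqP->].
Qed.

End Values.

Lemma hornerE_fprint (R : comNzRingType) (x : R) L : (fprint 'X L).[x] = fprint x L.
Proof. by rewrite horner_sum; apply: eq_bigr => it _; rewrite hornerXn. Qed.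

Lemma hornerE_inner (R : comNzRingType) (x : R) s L : (inner 'X s L).[x] = inner x s L.
Proof.
rewrite horner_sum; apply: eq_bigr => y _; rewrite hornerM !horner_sum.
congr (_ * _); first by apply: eq_bigr => e _; rewrite hornerXn.
apply: eq_bigr => z _; rewrite hornerM !horner_sum.
by congr (_ * _); apply: eq_bigr => e _; rewrite hornerXn.
Qed.

Section Polynomials.
Variable R : comNzRingType.
Implicit Types (L : seq (item n)) (s : stream n).

Lemma size_sum_leq (I : Type) (r : seq I) (P : pred I) (F : I -> {poly R}) N :
  (forall i, P i -> size (F i) <= N)%N ->
  (size (\sum_(i <- r | P i) F i)%R <= N)%N.
Proof.
move=> FN; apply: (big_ind (fun q : {poly R} => size q <= N)%N) => //.
  by rewrite size_poly0.
by move=> q q' sq sq'; rewrite (leq_trans (size_polyD _ _)) // geq_max sq.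
Qed.

Lemma size_sum_Xn_leq (I : Type) (r : seq I) (P : pred I) (F : I -> nat) N :
  (forall i, P i -> F i < N)%N ->
  (size (\sum_(i <- r | P i) 'X^(F i) : {poly R})%R <= N)%N.
Proof. by move=> FN; apply: size_sum_leq => i Pi; rewrite size_polyXn FN. Qed.

Lemma size_fprint L : (size (fprint ('X : {poly R}) L) <= 2 * n ^ 2)%N.
Proof. by apply: size_sum_Xn_leq => it _; exact: ltn_code. Qed.

Lemma size_inner s L : (size (inner ('X : {poly R}) s L) <= (mid.*2).+1)%N.
Proof.
(* For [a = 0] there are no vertices and the sums are empty; otherwise both factors have degree at
   most [mid]. *)
have [a0|a_gt0] := posnP a.
  rewrite /inner big1 ?size_poly0 // => y _; rewrite /fmat big1 ?mul0r // => e _.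
  by have := ltn_quo e.1; rewrite a0.
apply: size_sum_leq => y _.
have szF : (size (fmat 'X s y : {poly R}) <= mid.+1)%N.
  by apply: size_sum_Xn_leq => e _; rewrite ltnS arc_exp_leq.
have szG : (size (gmat 'X L y : {poly R}) <= mid.+1)%N.
  apply: size_sum_leq => z _; apply: leq_trans (size_polyMleq _ _) _.
  have s1 : (size (colsum 'X L z false y.1 : {poly R}) <= a)%N.
    apply: size_sum_Xn_leq => it /and3P[_ /eqP + _]; rewrite /item_exp => ->.
    lia.
  have s2 : (size (colsum 'X L z true y.2 : {poly R}) <= (a * a.-1).+1)%N.
    apply: size_sum_Xn_leq => it /and3P[_ /eqP + _]; rewrite /item_exp => ->.
    by rewrite ltnS leq_mul2l leq_subr orbT.
  have aa : (a * a.-1 + a = a * a)%N by rewrite -mulnSr prednK.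
  have le k l : (k <= a -> l <= (a * a.-1).+1 -> (k + l).-1 <= mid.+1)%N.
    by rewrite /mid; lia.
  exact: le s1 s2.
have le k l : (k <= mid.+1 -> l <= mid.+1 -> (k + l).-1 <= mid.*2.+1)%N by lia.
exact: leq_trans (size_polyMleq _ _) (le _ _ szF szG).
Qed.

Lemma coef_fprint L it : uniq L -> (fprint ('X : {poly R}) L)`_(code it) = (it \in L)%:R.
Proof.
move=> uL; rewrite coef_sum big_uniq //= big_mkcond /= (bigD1 it) //= big1.
  by rewrite coefXn eqxx addr0; case: (it \in L).
move=> j neq; rewrite coefXn (inj_eq (@code_inj n)) eq_sym (negPf neq).
by case: ifP.
Qed.

(** The coefficients are membership indicators. Distinctness matters: multiplicities would be
    visible only modulo the characteristic. *)
Lemma fprint_inj L L' : uniq L -> uniq L' ->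
  fprint ('X : {poly R}) L = fprint 'X L' -> perm_eq L L'.
Proof.
move=> uL uL' E; apply: uniq_perm => // it.
have := coef_fprint it uL; rewrite E coef_fprint //.
by do 2![case: (it \in _)] => // /eqP; rewrite ?oner_eq0 // eq_sym oner_eq0.
Qed.

(** For an arc [e] one needs the coefficient of exponent [mid - arc_exp e] in the cell of [e]. By
    [arc_item_exp] only items naming the ends of [e] contribute, leaving one term for each path
    through a [z]. *)
Lemma coef_inner s : (inner ('X : {poly R}) s (replay s))`_mid = (triangle_count s)%:R.
Proof.
have -> : inner 'X s (replay s) =
    \sum_(e | darc s e.1 e.2) 'X^(arc_exp e) * gmat ('X : {poly R}) (replay s) (res2 e).
  rewrite (partition_big res2 predT) //=; apply: eq_bigr => y _.
  by rewrite big_distrl /=; apply: eq_bigr => e /andP[_ /eqP->].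
rewrite triangle_countE natr_sum coef_sum; apply: eq_bigr => e _.
rewrite coefXnM ltnNge arc_exp_leq /= natr_sum coef_sum; apply: eq_bigr => z _.
rewrite !colsum_replay big_distrlr coef_sum /=.
under eq_bigr => u /andP[_ /eqP ru].
  rewrite coef_sum.
  under eq_bigr => v /andP[_ /eqP rv] do rewrite -exprD coefXn arc_item_exp //.
  over.
rewrite /= big_mkcond (bigD1 e.1) //= [X in _ + X]big1 => [|u /negPf neq].
  rewrite addr0 !eqxx andbT /item_of /=; case: (darc s e.1 z) => //=.
  rewrite big_mkcond (bigD1 e.2) //= [X in _ + X]big1 => [|v /negPf neq].
    by rewrite addr0 !eqxx andbT; case: (darc s z e.2).
  by rewrite neq; case: ifP.
by case: ifP => // _; rewrite big1 // => v _; rewrite neq.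
Qed.

End Polynomials.
End Sketch.

(** * The protocol *)

Section Protocol.
Local Open Scope ring_scope.
Variables (n a b rb : nat) (F : finFieldType) (nat_of : F -> nat).
Hypotheses (b_gt0 : (0 < b)%N) (le_n_ab : (n <= a * b)%N).
Variable point : {ffun 'I_rb -> bool} -> F.
Local Notation res := (res b_gt0).
Local Notation res2 := (res2 b_gt0).
Local Notation item := (item n).
Local Notation item_exp := (@item_exp n a b).
Local Notation arc_exp := (@arc_exp n a b).
Local Notation mid := (mid a).
Local Notation grid := {ffun 'I_b * 'I_b -> F}.

(** Last item read, column sums of the current vertex only, accumulated G grid, fingerprint of the
    items. *)
Definition istate := (option item * {ffun bool * 'I_b -> F} * grid * F)%type.

(** Under increasing codes a vertex that was left never returns, so its column sums can be
    discarded. *)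
Definition carry (l : option item) (c : {ffun bool * 'I_b -> F}) (it : item) :
    {ffun bool * 'I_b -> F} :=
  if l is Some j then if j.1.1 == it.1.1 then c else [ffun=> 0] else [ffun=> 0].

Definition item_step (x : F) (o : option istate) (it : item) : option istate :=
  if o is Some (l, c, G, K) then
    if (if l is Some j then code_lt j it else true) then
      let c0 := carry l c it in
      let w := x ^+ item_exp it in
      Some (Some it,
        [ffun di => c0 di + (if (it.1.2, res it.2) == di then w else 0)],
        [ffun y => G y +
           (if it.1.2 then c0 (false, y.1) * (if res it.2 == y.2 then w else 0)
            else (if res it.2 == y.1 then w else 0) * c0 (true, y.2))],
        K + x ^+ code it)
    else None
  else None.

Definition items_state (x : F) (L : seq item) : istate :=
  let l := last None (map Some L) in
  (l, [ffun di : bool * 'I_b =>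
     (if l is Some j then colsum a b_gt0 x L j.1.1 di.1 di.2 else 0 : F)],
   [ffun y => gmat a b_gt0 x L y], fprint x L).

Lemma foldl_item_step x L :
  foldl (item_step x) (Some (None, [ffun=> 0], [ffun=> 0], 0)) L =
  if pairwise (@code_lt n) L then Some (items_state x L) else None.
Proof.
elim/last_ind: L => [|L it IHL].
  rewrite /items_state /= /fprint big_nil; congr (Some (_, _, _, _)); apply/ffunP => y.
  by rewrite !ffunE /gmat big1 // => z _; rewrite /colsum big_nil mul0r.
rewrite foldl_rcons {}IHL pairwise_rcons; case: ifP => [pL|_]; last by rewrite andbF.
rewrite andbT /item_step /items_state map_rcons last_rcons.
set l := last None (map Some L).
have lP : if l is Some j then j \in L /\ {in L, forall i, code i <= code j}%N
          else L = [::].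
  rewrite /l; case/lastP: (L) pL => // L' j; rewrite pairwise_rcons => /andP[/allP ltj _].
  rewrite map_rcons last_rcons mem_rcons mem_head; split=> // i.
  by rewrite mem_rcons inE => /predU1P[->//|/ltj]; exact: ltnW.
(* By transitivity, comparing with the last item alone tests the new item against all earlier
   ones. *)
have -> : (if l is Some j then code_lt j it else true) = all (fun i : item => code_lt i it) L.
  rewrite {lP}/l; case/lastP: (L) pL => // L' j; rewrite pairwise_rcons => /andP[/allP ltj _].
  rewrite map_rcons last_rcons all_rcons; case: (boolP (code_lt j it)) => //= ltjt.
  by apply/esym/allP => i /ltj; rewrite /code_lt => /ltn_trans; apply.
case: ifP => // /allP lt_it.
pose c0 (di : bool * 'I_b) := colsum a b_gt0 x L it.1.1 di.1 di.2.
pose cL : {ffun bool * 'I_b -> F} := [ffun di : bool * 'I_b =>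
  (if l is Some j then colsum a b_gt0 x L j.1.1 di.1 di.2 else 0 : F)].
(* After a change of vertex the true column sums are empty: an earlier item at the new vertex would,
   by monotonicity, force the last item there too. *)
rewrite -/cL; have c1E di : carry l cL it di = c0 di.
  rewrite /carry /cL /c0; case: (l) lP => [j jP|->]; last by rewrite ffunE /colsum big_nil.
  case: eqP => [<-|neq]; rewrite ffunE // /colsum big_seq_cond big1 //.
  move=> i /andP[iL /and3P[/eqP ei _ _]].
  case: neq; have [jL /(_ i iL)] := jP; rewrite leq_eqVlt => /predU1P[|lt_ij].
    by move/code_inj <-.
  apply: ord_inj; apply/eqP; rewrite eqn_leq (code_vertex_mono (lt_it j jL)).
  by rewrite -ei (code_vertex_mono lt_ij).
congr (Some (_, _, _, _)).
- apply/ffunP => -[d i]; rewrite !ffunE c1E /c0 colsum_rcons eqxx /=.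
  by rewrite xpair_eqE.
- by apply/ffunP => y; rewrite !ffunE gmat_rcons !c1E.
- by rewrite /fprint big_rcons /=.
Qed.

(** Number of coefficients read, value at [x] so far, coefficient at [mid]. The counter must also
    hold the full length [mid.*2.+1]. *)
Definition cstate := ('I_(mid.*2.+1).+1 * F * F)%type.

Definition coef_step (x : F) (o : option cstate) (c : F) : option cstate :=
  if o is Some (i, acc, ans) then
    if (i < mid.*2.+1)%N then
      Some (inord i.+1, acc + c * x ^+ i, if i == mid :> nat then c else ans)
    else None
  else None.

Lemma horner_Poly_rcons x (cs : seq F) c :
  (Poly (rcons cs c)).[x] = (Poly cs).[x] + c * x ^+ size cs.
Proof.
rewrite !horner_Poly; elim: cs => [|c' cs IHcs] /=; first by rewrite mul0r expr0 mulr1.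
by rewrite IHcs mulrDl exprSr mulrA addrAC.
Qed.

Lemma foldl_coef_step x cs :
  foldl (coef_step x) (Some (ord0, 0, 0)) cs =
  if (size cs <= mid.*2.+1)%N
  then Some (inord (size cs), (Poly cs).[x], cs`_mid) else None.
Proof.
elim/last_ind: cs => [|cs c IHcs].
  rewrite horner_Poly nth_nil; congr (Some (_, _, _)).
  by apply: val_inj; rewrite /= inordK.
rewrite foldl_rcons {}IHcs size_rcons /coef_step; case: ifP => [le_cs|nle]; last first.
  by case: ifP => // /ltnW; rewrite nle.
rewrite inordK ?ltnS //; case: ifP => // lt_cs.
rewrite horner_Poly_rcons nth_rcons; case: (ltngtP mid (size cs)) => // gt_cs.
(* Until coefficient [mid] arrives, the stored answer is the default 0 of [nth]. *)
by rewrite nth_default // ltnW.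
Qed.

(** Evaluation point, fingerprint of the input, F grid, and the states of the two help checks, where
    [None] means rejection. *)
Definition vstate := (F * F * grid * option istate * option cstate)%type.

Definition vinit (rho : {ffun 'I_rb -> bool}) : vstate :=
  (point rho, 0, [ffun=> 0], Some (None, [ffun=> 0], [ffun=> 0], 0),
   Some (ord0, 0, 0)).

Definition vedge (q : vstate) (e0 : 'I_n * 'I_n) : vstate :=
  let: (x, K, f, o, o') := q in
  let e := orient e0 in
  (x, K + (x ^+ code (e.2, false, e.1) + x ^+ code (e.1, true, e.2)),
   [ffun y => f y + (if res2 e == y then x ^+ arc_exp e else 0)], o, o').

Definition vsym (q : vstate) (m : item + F) : vstate :=
  let: (x, K, f, o, o') := q in
  match m with
  | inl it => (x, K, f, item_step x o it, o')
  | inr c => (x, K, f, o, coef_step x o' c)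
  end.

Definition vout (q : vstate) : option nat :=
  let: (x, K, f, o, o') := q in
  match o, o' with
  | Some (_, _, G, K'), Some (_, acc, ans) =>
      if (K == K') && (acc == \sum_y f y * G y) then Some (nat_of ans) else None
  | _, _ => None
  end.

Definition items_of (t : seq (item + F)) : seq item :=
  pmap (fun m => if m is inl it then Some it else None) t.
Definition coefs_of (t : seq (item + F)) : seq F :=
  pmap (fun m => if m is inr c then Some c else None) t.

Lemma foldl_vedge s x o o' : valid_stream s ->
  foldl vedge (x, 0, [ffun=> 0], o, o') s =
  (x, fprint x (replay s), [ffun y => fmat a b_gt0 x s y], o, o').
Proof.
move=> vs; rewrite /fprint sum_replay_arcs.
rewrite -(sum_orient (fun e => x ^+ code (e.2, false, e.1) + x ^+ code (e.1, true, e.2)) vs).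
have -> : [ffun y => fmat a b_gt0 x s y] = [ffun y =>
    \sum_(e <- s) if res2 (orient e) == y then x ^+ arc_exp (orient e) else 0].
  apply/ffunP => y; rewrite !ffunE /fmat.
  by rewrite (sum_orient (fun e => if res2 e == y then x ^+ arc_exp e else 0) vs) -big_mkcondr.
elim/last_ind: s {vs} => [|s e IHs].
  by rewrite /= big_nil; congr (_, _, _, _, _); apply/ffunP => y; rewrite !ffunE big_nil.
rewrite foldl_rcons IHs /vedge big_rcons /=; congr (_, _, _, _, _).
by apply/ffunP => y; rewrite !ffunE big_rcons.
Qed.

Lemma foldl_vsym x K f o o' t :
  foldl vsym (x, K, f, o, o') t =
  (x, K, f, foldl (item_step x) o (items_of t), foldl (coef_step x) o' (coefs_of t)).
Proof. by elim: t o o' => //= -[it|c] t IHt o o'; rewrite IHt. Qed.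

(** Items and coefficients act on separate components, so their interleaving is irrelevant. The
    first two tests do not depend on the random point. *)
Lemma sym_runE s rho t : valid_stream s -> let x := point rho in
  sym_run vinit vedge vsym vout rho s t =
  if [&& pairwise (@code_lt n) (items_of t), (size (coefs_of t) <= mid.*2.+1)%N,
         fprint x (replay s) == fprint x (items_of t) &
         (Poly (coefs_of t)).[x] == inner a b_gt0 x s (items_of t)]
  then Some (nat_of (coefs_of t)`_mid) else None.
Proof.
move=> vs x; rewrite /sym_run /vinit foldl_vedge // foldl_vsym.
rewrite foldl_item_step foldl_coef_step /vout.
case: pairwise => //=; case: leqP => //= _.
by under eq_bigr => y _ do rewrite !ffunE.
Qed.

Definition honest s : seq (item + F) :=
  map inl (replay s) ++
  map inr (mkseq (fun i => (inner a b_gt0 ('X : {poly F}) s (replay s))`_i) mid.*2.+1).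

Lemma items_of_honest s : items_of (honest s) = replay s.
Proof.
rewrite /items_of /honest pmap_cat map_pK // [X in _ ++ X](_ : _ = [::]) ?cats0 //.
by elim: mkseq.
Qed.

Lemma coefs_of_honest s : coefs_of (honest s) =
  mkseq (fun i => (inner a b_gt0 ('X : {poly F}) s (replay s))`_i) mid.*2.+1.
Proof.
rewrite /coefs_of /honest pmap_cat [X in X ++ _](_ : _ = [::]); last by elim: replay.
by rewrite map_pK.
Qed.

Lemma size_honest s : valid_stream s -> size (honest s) = (2 * size s + mid.*2.+1)%N.
Proof. by move=> vs; rewrite size_cat !size_map size_iota size_replay. Qed.

(** * Completeness, soundness and number of states *)

Hypothesis nat_ofK : forall k, (k <= n ^ 3)%N -> nat_of k%:R = k.
Hypothesis point_inj : injective point.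

Lemma honest_complete s : valid_stream s -> forall rho,
  sym_run vinit vedge vsym vout rho s (honest s) = Some (triangle_count s).
Proof.
move=> vs rho; rewrite sym_runE // items_of_honest coefs_of_honest.
rewrite replay_pairwise size_mkseq leqnn eqxx !andTb nth_mkseq; last by lia.
rewrite (coef_inner b_gt0 le_n_ab) nat_ofK ?triangle_count_leq //.
rewrite -(hornerE_inner a b_gt0 (point rho)).
set P := inner a b_gt0 'X s _; rewrite (_ : Poly _ = P) ?eqxx //.
apply/polyP => i; rewrite coef_Poly; case: (ltnP i mid.*2.+1) => [lt_i|le_i].
  by rewrite nth_mkseq.
by rewrite !nth_default ?size_mkseq // (leq_trans (size_inner b_gt0 le_n_ab _ _ _)).
Qed.

Lemma card_roots (P : {poly F}) N (B : {set {ffun 'I_rb -> bool}}) :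
  P != 0 -> (size P <= N)%N -> {in B, forall rho, root P (point rho)} -> (#|B| <= N)%N.
Proof.
move=> P_neq0 szP rootB; apply: leq_trans szP; apply: ltnW.
rewrite cardE -(size_map point); apply: max_poly_roots => //.
  by apply/allP => _ /mapP[rho + ->]; rewrite mem_enum => /rootB.
by rewrite map_inj_uniq ?enum_uniq.
Qed.

(** For a fixed help message, all fooled points are roots of one nonzero polynomial: the difference
    of the fingerprints if these differ, otherwise the difference between the claimed and the true
    product polynomial. *)
Lemma card_fooled s t : valid_stream s -> (mid.*2.+1 <= 2 * n ^ 2)%N ->
  (#|[set rho | (sym_run vinit vedge vsym vout rho s t != Some (triangle_count s)) &&
                (sym_run vinit vedge vsym vout rho s t != None)]| <= 2 * n ^ 2)%N.
Proof.
move=> vs le_mid; set B := [set _ | _].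
(* One fooled [rho0] already shows that the point-independent tests pass and that the claimed answer
   is wrong. *)
have [->|[rho0]] := set_0Vmem B; first by rewrite cards0.
rewrite inE sym_runE //; case: ifP => [|_]; last by rewrite eqxx andbF.
case/and4P=> ltL szcs _ _ /andP[wrong _].
pose L := items_of t; pose cs := coefs_of t.
have BP rho : rho \in B -> let x := point rho in
    fprint x (replay s) = fprint x L /\ (Poly cs).[x] = inner a b_gt0 x s L.
  by rewrite inE sym_runE //; case: ifP => [/and4P[_ _ /eqP ? /eqP ?]|_] //.
have [eqK|neqK] := eqVneq (fprint ('X : {poly F}) (replay s)) (fprint 'X L); last first.
  apply: (@card_roots (fprint 'X (replay s) - fprint 'X L)); first by rewrite subr_eq0.
    by rewrite (leq_trans (size_polyD _ _)) // size_polyN geq_max !size_fprint.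
  move=> rho /BP[eqx _]; rewrite /root hornerD hornerN !hornerE_fprint eqx subrr.
  exact: eqxx.
have permL := fprint_inj (replay_uniq s) (code_lt_uniq ltL) eqK.
apply: (@card_roots (Poly cs - inner a b_gt0 'X s L)).
(* Equal polynomials would agree at [mid], making the answer right. *)
- apply: contra wrong => /eqP/subr0_eq eqPQ; apply/eqP; congr Some.
  rewrite -(nat_ofK (triangle_count_leq s)) -(coef_inner b_gt0 le_n_ab).
  by rewrite (perm_inner _ _ _ _ permL) -eqPQ coef_Poly.
- rewrite (leq_trans (size_polyD _ _)) // size_polyN geq_max.
  rewrite (leq_trans (size_Poly _)) ?(leq_trans szcs) //=.
  exact: leq_trans (size_inner b_gt0 le_n_ab _ _ _) le_mid.
- by move=> rho /BP[_ eqx]; rewrite /root hornerD hornerN hornerE_inner eqx subrr.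
Qed.

Lemma card_vstate : (0 < n)%N -> (8 * n ^ 3 < #|F|)%N -> (a <= n)%N ->
  (#|{: vstate}| <= #|F| ^ (13 * b ^ 2))%N.
Proof.
clear le_n_ab => n_gt0 ltF le_an; rewrite !(card_prod, card_option, card_ffun, card_bool, card_ord).
set f := #|F| in ltF *.
have n2 : (2 * n ^ 2 + 2 < f)%N.
  by apply: leq_ltn_trans ltF; rewrite (expnS n 2); have : (0 < n ^ 2)%N; nia.
have f_gt1 : (1 < f)%N by lia.
have succ_le X e : (X <= f ^ e -> X.+1 <= f ^ e.+1)%N.
  move=> leX; have : (0 < f ^ e)%N by rewrite expn_gt0 ltnW.
  by rewrite expnS; nia.
have le1 : ((n * 2 * n).+1 <= f ^ 1)%N by rewrite expn1; lia.
have le2 : (mid.*2.+1.+1 <= f ^ 1)%N.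
  rewrite expn1 /mid; have : (a * a <= n ^ 2)%N by rewrite leq_mul. lia.
have leM X Y e e' : (X <= f ^ e -> Y <= f ^ e' -> X * Y <= f ^ (e + e'))%N.
  by move=> leX leY; rewrite expnD leq_mul.
have leF : (f <= f ^ 1)%N by rewrite expn1.
(* The exponent follows the components of [vstate], with one extra factor for each of the two outer
   options; [2 b^2 + 2 b + 9 <= 13 b^2] as [b > 0]. *)
apply: (@leq_trans (f ^ (1 + 1 + b * b + (1 + 2 * b + b * b + 1).+1 + (1 + 1 + 1).+1))%N).
  by repeat first [exact: le1 | exact: le2 | exact: leF | exact: leqnn | apply leM | apply succ_le].
by rewrite leq_exp2l //; nia.
Qed.
End Protocol.

(** * Parameters *)

Lemma exists_sqrt v : exists b, b ^ 2 <= v < b.+1 ^ 2.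
Proof.
elim: v => [|v [b /andP[b1 b2]]]; first by exists 0.
case: (ltnP v.+1 (b.+1 ^ 2)) => le; first by exists b; rewrite (leqW b1).
by exists b.+1; rewrite le /=; nia.
Qed.

(* [b] is about [sqrt v], capped at [n], and [a] is [n / b] rounded up. *)
Lemma exists_grid n h v : 0 < n -> n ^ 2 <= h * v ->
  exists a b, [/\ 0 < b, n <= a * b, a <= n, b ^ 2 <= v & a ^ 2 <= 16 * h].
Proof.
move=> n_gt0 le_hv; have [r /andP[r1 r2]] := exists_sqrt v.
have hv_gt0 : 0 < h * v by apply: leq_trans le_hv; rewrite expn_gt0 n_gt0.
have [h_gt0 v_gt0] : 0 < h /\ 0 < v by move: hv_gt0; rewrite muln_gt0 => /andP.
have r_gt0 : 0 < r by move: r2; case: (r) => //; lia.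
case: (leqP n r) => [le_nr|lt_rn].
  exists 1, n; split; rewrite ?mul1n //; last by lia.
  by apply: leq_trans r1; rewrite leq_exp2r.
exists ((n + r.-1) %/ r), r; set a := _ %/ r.
have a1 : a * r <= n + r.-1 by exact: leq_divM.
have a2 : n + r.-1 < a.+1 * r by exact: ltn_ceil.
have le_an : a <= n by nia.
split=> //; first by nia.
(* The 16 comes from [(a r)^2 <= 4 n^2 <= 4 h v <= 16 h r^2], using [a r <= 2 n] and
   [v < (r+1)^2 <= 4 r^2]. *)
have le1 : (a * r) ^ 2 <= 4 * n ^ 2.
  by rewrite -[4]/(2 ^ 2) -expnMn leq_exp2r //; lia.
have le2 : v <= 4 * r ^ 2.
  by apply: leq_trans (ltnW r2) _; rewrite -[4]/(2 ^ 2) -expnMn leq_exp2r //; lia.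
have r2_gt0 : 0 < r ^ 2 by rewrite expn_gt0 r_gt0.
rewrite -(leq_pmul2r r2_gt0) -expnMn.
apply: leq_trans le1 _; apply: (@leq_trans (4 * (h * v))); first by rewrite leq_mul2l.
apply: (@leq_trans (4 * (h * (4 * r ^ 2)))); first by rewrite !leq_mul2l le2 !orbT.
by rewrite !mulnA (mulnAC 4 h 4).
Qed.

Lemma triangle_scheme_pos n h v : 0 < n -> n ^ 2 <= h * v ->
  exists S : scheme n,
    [/\ complete S (@triangle_count n), sound S (@triangle_count n),
        v_space (s_ver S) <= 300 * v * polylog n 1 &
        forall s : stream n, valid_stream s ->
          size (s_help S s) <= 600 * (num_edges s + h) * polylog n 1].
Proof.
move=> n_gt0 le_hv; have [a [b [b_gt0 le_nab le_an b2v a2h]]] := exists_grid n_gt0 le_hv.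
rewrite /polylog expn1; set l := (trunc_log 2 n).+1.
(* The lower bound on [p] embeds the [3 l + 3] random bits in the field and makes counts up to [n^3]
   recoverable; the upper bound stores a field element in [6 l + 9] bits. *)
have [p p_pr /andP[lt_p le_p]] := exists_prime_between (3 * l + 3).
have n3 : 8 * n ^ 3 <= 2 ^ (3 * l + 3).
  rewrite mulnC expnD leq_mul // mulnC expnM leq_exp2r //; exact/ltnW/trunc_log_ltn.
have n2 : 0 < n ^ 2 by rewrite expn_gt0 n_gt0.
have n23 : n ^ 2 <= n ^ 3 by rewrite leq_pexp2l.
have card_F : #|'F_p| = p by rewrite card_Fp.
have n_lt_p : n ^ 3 < p by lia.
pose nat_of (x : 'F_p) : nat := x.
have nat_ofK k : k <= n ^ 3 -> nat_of k%:R%R = k.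
  by move=> le_k; rewrite /nat_of val_Fp_nat // modn_small //; lia.
pose point (rho : {ffun 'I_(3 * l + 3) -> bool}) : 'F_p := ((enum_rank rho)%:R)%R.
have point_inj : injective point.
  move=> rho rho' /(congr1 val); rewrite /= !val_Fp_nat //.
  have lt_rank (x : {ffun 'I_(3 * l + 3) -> bool}) : enum_rank x < p.
    apply: leq_trans (ltn_ord _) _.
    by rewrite cardE -cardT card_ffun card_bool card_ord ltnW.
  by rewrite !modn_small // => /ord_inj/enum_rank_inj.
(* There are [2 n^2 + p <= 2 p] symbols, hence one bit more than for a field element. *)
pose kb := (6 * l + 9).+1; pose sp := (6 * l + 9) * (13 * b ^ 2).
have le_p' : p <= 2 ^ (6 * l + 9).
  by have -> : 6 * l + 9 = 2 * (3 * l + 3) + 3 by lia.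
have le_mid : (mid a).*2.+1 <= 2 * n ^ 2.
  by have : a * a <= n ^ 2 := leq_mul le_an le_an; rewrite /mid; lia.
have [//|||| |S [cmpl snd spE helpE]] := @machine_scheme n (3 * l + 3) kb sp
  (vstate n a b 'F_p) (item n + 'F_p)%type (vinit n a b point [ffun=> false]) (inr 0%R)
  (vinit n a b point) (vedge b_gt0) (vsym b_gt0) (vout nat_of)
  (@triangle_count n) (honest a 'F_p b_gt0).
- apply: leq_trans (card_vstate b_gt0 n_gt0 _ le_an) _; first by rewrite card_F; lia.
  by rewrite card_F /sp (expnM 2) leq_exp2r // muln_gt0 expn_gt0 b_gt0.
- rewrite card_sum card_F !card_prod card_bool !card_ord /kb expnS.
  by move: le_p' le_mid; nia.
- by move=> s vs rho; apply: honest_complete.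
(* At most [2 n^2] of the [2^(3l+3) >= 8 n^3] random strings are fooled. *)
- move=> s vs t; apply: (@leq_trans (3 * (2 * n ^ 2))).
    by rewrite leq_mul2l /=; apply: card_fooled.
  by lia.
exists S; split=> //.
  rewrite spE /sp /kb; have v_gt0 : 0 < v by apply: leq_trans b2v; rewrite expn_gt0 b_gt0.
  have l_gt0 : 0 < l by [].
  have le1 : (6 * l + 9) * (13 * b ^ 2) <= 15 * l * (13 * v) by apply: leq_mul; lia.
  have : l <= v * l by rewrite leq_pmull.
  by move: le1; rewrite -!mulnA (mulnCA l 13) (mulnC l v); lia.
move=> s vs; rewrite helpE size_honest // /num_edges.
have a2 : (mid a).*2.+1 <= 32 * h.
  have h_gt0 : 0 < h by case: (h) le_hv; lia.
  by have : a * a <= 16 * h := a2h; rewrite /mid; lia.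
have le_kb : kb <= 16 * l by rewrite /kb; have : 0 < l by []; lia.
apply: (@leq_trans (16 * l * (2 * size s + 32 * h))); first by rewrite leq_mul ?leq_add2l.
by rewrite (mulnC (600 * _)) -mulnA (mulnC 16) -mulnA leq_mul2l; lia.
Qed.

(** For [n = 0] the values [h = v = 0] are allowed, so this scheme must use no memory and no
    help. *)
Lemma triangle_scheme0 : exists S : scheme 0,
  [/\ complete S (@triangle_count 0), sound S (@triangle_count 0),
      v_space (s_ver S) = 0 & forall s : stream 0, size (s_help S s) = 0].
Proof.
pose m0 : Defs.mem 0 := [ffun=> false].
exists (Scheme (@Verifier 0 0 0 (fun=> m0) (fun _ _ => m0) (fun _ _ => m0) (fun=> Some 0))
               (fun=> [::])).
have T0 s : @triangle_count 0 s = 0.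
  by have := triangle_count_leq s; rewrite exp0n // leqn0 => /eqP.
split=> // s _; first by move=> rho; rewrite /run T0.
by move=> help; rewrite /run T0 /= (eq_card (B := pred0)) ?card0 // => rho; rewrite inE.
Qed.

Lemma triangle_scheme n h v : n ^ 2 <= h * v ->
  exists S : scheme n,
    [/\ complete S (@triangle_count n), sound S (@triangle_count n),
        v_space (s_ver S) <= 300 * v * polylog n 1 &
        forall s : stream n, valid_stream s ->
          size (s_help S s) <= 600 * (num_edges s + h) * polylog n 1].
Proof.
case: (posnP n) => [->|n_gt0]; last exact: triangle_scheme_pos.
move=> _; have [S [cmpl snd spE helpE]] := triangle_scheme0.
by exists S; split=> // [|s _]; rewrite ?spE ?helpE.
Qed.

Theorem theorem4p5 :
  exists C c : nat,
    (* for any h, v with h v >= n^2: an [m+h, v]-scheme for TriangleCount *)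
    (forall n h v : nat, n ^ 2 <= h * v ->
      exists S : scheme n,
        complete S (@triangle_count n) /\ sound S (@triangle_count n) /\
        v_space (s_ver S) <= C * v * polylog n c /\
        (forall s : stream n, valid_stream s ->
           size (s_help S s) <= C * (num_edges s + h) * polylog n c)) /\
    (* in particular, an [m, n^2/m]-scheme *)
    (forall n m : nat, 0 < m ->
      exists S : scheme n,
        complete S (@triangle_count n) /\ sound S (@triangle_count n) /\
        v_space (s_ver S) <= C * ((n ^ 2 + m.-1) %/ m) * polylog n c /\
        (forall s : stream n, valid_stream s -> num_edges s = m ->
           size (s_help S s) <= C * m * polylog n c)).
Proof.
(* The second claim takes [h = m], which doubles the help constant 600. *)
exists 1200, 1; split=> [n h v /triangle_scheme[S [cmpl snd spS helpS]]|n m m_gt0].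
  exists S; do 2![split=> //]; split=> [|s vs].
    by apply: leq_trans spS _; rewrite !leq_mul.
  by apply: leq_trans (helpS s vs) _; rewrite !leq_mul.
have [|S [cmpl snd spS helpS]] := @triangle_scheme n m ((n ^ 2 + m.-1) %/ m).
  (* Rounding [n^2 / m] up ensures [n^2 <= h v]. *)
  by have := ltn_ceil (n ^ 2 + m.-1) m_gt0; nia.
exists S; do 2![split=> //]; split=> [|s vs sz].
  by apply: leq_trans spS _; rewrite !leq_mul.
by apply: leq_trans (helpS s vs) _; rewrite sz; apply: leq_mul => //; lia.
Qed.
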